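(* Let $d\ge1$ and let $\Upsilon$ be a finite pure $d$-dimensional simplicial complex. Then \[ m_{\Upsilon}(d)\ge p_d(\Upsilon)-q_d(\Upsilon). \]
   Context: A finite abstract simplicial complex $\Upsilon$ is a collection of subsets (faces) of a finite vertex set closed under taking subsets; a face $\sigma$ has dimension $|\sigma|-1$. Facets are inclusion-maximal faces; $\Upsilon$ is pure of dimension $d$ if every facet has dimension $d$. A ridge is a $(d-1)$-face. Choose an orientation of every face; $C_i(\Upsilon;\mathbb{R})$ is the real vector space with the oriented $i$-faces as orthonormal basis, and $\partial_i:C_i(\Upsilon;\mathbb{R})\to C_{i-1}(\Upsilon;\mathbb{R})$, $\partial_i[v_0,\ldots,v_i]=\sum_{j=0}^i(-1)^j[v_0,\ldots,\widehat{v_j},\ldots,v_i]$, is the boundary operator, identified with its matrix. The upper Laplacian on ridges is $L_{d-1}^{\mathrm{up}}(\Upsilon)=\partial_d\partial_d^{\mathsf T}$ (its spectrum does not depend on the orientations). For a real number $\lambda>0$, $m_{\Upsilon}(\lambda)$ is the multiplicity of $\lambda$ as an eigenvalue of $L_{d-1}^{\mathrm{up}}(\Upsilon)$ (equal to $0$ if $\lambda$ is not an eigenvalue); $m_\Upsilon(d)$ is the multiplicity of the number $\lambda=d$. A ridge is free if it is contained in exactly one facet, otherwise nonfree. A facet is pendant if exactly $d$ of its $d+1$ ridges are free; $p_d(\Upsilon)$ is the number of pendant facets. A nonfree ridge is quasi-pendant if it is contained in at least one pendant facet; $q_d(\Upsilon)$ is the number of quasi-pendant ridges. *)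

(* Defs.v *)
From HB Require Import structures.
From mathcomp Require Import all_boot all_order all_algebra.
From mathcomp Require Import reals.

Set Implicit Arguments.
Unset Strict Implicit.
Unset Printing Implicit Defensive.

Import Order.TTheory GRing.Theory Num.Theory.
Local Open Scope ring_scope.

Definition simplicial_complex (V : finType) (K : {set {set V}}) : Prop :=
  forall s t : {set V}, s \in K -> t \subset s -> t \in K.

(* Integer-valued, so that the empty face has dimension -1. *)
Definition face_dim (V : finType) (s : {set V}) : int := #|s|%:Z - 1.

Definition faces (V : finType) (K : {set {set V}}) (i : int) : {set {set V}} :=
  [set s in K | face_dim s == i].

Definition facets (V : finType) (K : {set {set V}}) : {set {set V}} :=
  [set s | maxset [pred t : {set V} | t \in K] s].

Definition pure (V : finType) (K : {set {set V}}) (d : int) : Prop :=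
  forall s, s \in facets K -> face_dim s = d.

(* An orientation of a face is represented by a listing of its vertices; two
   listings that differ by an even permutation give the same oriented basis
   element. *)
Definition orientation (V : finType) (K : {set {set V}})
    (o : {set V} -> seq V) : Prop :=
  forall s, s \in K -> perm_eq (o s) (enum s).

(* The number of inversions of the permutation that takes the listing s to the
   listing t of the same vertices. *)
Definition inversions (V : finType) (s t : seq V) : nat :=
  #|[set p : V * V | [&& p.1 \in s, p.2 \in s,
       (index p.1 s < index p.2 s)%N & (index p.2 t < index p.1 t)%N]]|.

(* The coefficient of the oriented simplex [v_0, ..., v_k], where s is the
   sequence v_0, ..., v_k, on the basis element given by the oriented face t. *)
Definition oriented_coef (R : realType) (V : finType) (o : {set V} -> seq V)
    (s : seq V) (t : {set V}) : R :=
  if perm_eq s (o t) then (-1) ^+ inversions s (o t) else 0.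

Definition omit (V : finType) (j : nat) (s : seq V) : seq V :=
  take j s ++ drop j.+1 s.

(* The matrix of the boundary operator from C_i to C_(i-1), acting on columns,
   in the bases of oriented faces. *)
Definition boundary (R : realType) (V : finType) (K : {set {set V}})
    (o : {set V} -> seq V) (i : int) :
    'M[R]_(#|faces K (i - 1)|, #|faces K i|) :=
  \matrix_(r, c) \sum_(j < size (o (enum_val c)))
    (-1) ^+ j * oriented_coef R o (omit j (o (enum_val c))) (enum_val r).

(* The upper Laplacian in dimension d - 1. *)
Definition ridge_laplacian (R : realType) (V : finType) (K : {set {set V}})
    (o : {set V} -> seq V) (d : int) : 'M[R]_#|faces K (d - 1)| :=
  boundary R K o d *m (boundary R K o d)^T.

(* Only used for symmetric matrices, for which the algebraic and geometric
   multiplicities coincide and row and column eigenspaces are transposes of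
   each other. *)
Definition eigen_multiplicity (R : realType) (n : nat) (A : 'M[R]_n) (a : R) :
    nat :=
  \rank (eigenspace A a).

Definition ridges (V : finType) (K : {set {set V}}) (d : int) :
    {set {set V}} :=
  faces K (d - 1).

Definition free_ridge (V : finType) (K : {set {set V}}) (t : {set V}) : bool :=
  #|[set s in facets K | t \subset s]| == 1%N.

Definition pendant_facets (V : finType) (K : {set {set V}}) (d : nat) :
    {set {set V}} :=
  [set s in facets K |
    #|[set t in ridges K d%:Z | (t \subset s) && free_ridge K t]| == d].

Definition quasi_pendant_ridges (V : finType) (K : {set {set V}}) (d : nat) :
    {set {set V}} :=
  [set t in ridges K d%:Z | ~~ free_ridge K t &
    [exists s in pendant_facets K d, t \subset s]].

(* Main.v *)
Require Import Defs.
From HB Require Import structures.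
From mathcomp Require Import all_boot all_order all_algebra.
From mathcomp Require Import zify.
From mathcomp Require Import reals.

Set Implicit Arguments.
Unset Strict Implicit.
Unset Printing Implicit Defensive.

Import Order.TTheory GRing.Theory Num.Theory.
Local Open Scope ring_scope.

(** Write [B] for the boundary matrix, so that the Laplacian is [B *m B^T].
    On the other side, [B^T *m B] acts on the chains of facets.  A pendant
    facet [s] shares none of its [d] free ridges with another facet, so these
    ridges contribute exactly [d] times [s] to the image of [s] under
    [B^T *m B], and the remaining contribution comes from a nonfree ridge of
    [s], which is quasi-pendant ([boundary_coef_pendant]).  Hence
    [B^T *m B - d] maps the span of the [p] pendant facets into a space spanned
    by [q] vectors, and its kernel on that span has dimension at least [p - q].
    Since [d] is nonzero, applying the boundary embeds this kernel into the
    [d]-eigenspace of [B *m B^T] ([rank_eigenspace_mulmx]).  The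
    orientations enter only through the squares of the incidence numbers, which
    are 1 or 0 ([sqr_boundary_coef]). *)

(** The kernel of [X] has dimension at least [p - q]; on the corresponding
    combinations of the rows of [P], right multiplication by [A *m C] is
    multiplication by the nonzero [a], so [A] is injective there and its image
    consists of eigenvectors of [C *m A]. *)
Lemma rank_eigenspace_mulmx (F : fieldType) (m n p q : nat) (a : F)
    (A : 'M[F]_(m, n)) (C : 'M[F]_(n, m)) (P : 'M[F]_(p, m))
    (X : 'M[F]_(p, q)) (Y : 'M[F]_(q, m)) :
  a != 0 -> row_free P -> P *m A *m C = a *: P + X *m Y ->
  (p <= q + \rank (eigenspace (C *m A) a))%N.
Proof.
move=> a0 Pfree PAC.
set U := kermx X *m P.
have UAC : U *m A *m C = a *: U.
  rewrite /U -2!mulmxA (mulmxA P) PAC mulmxDr mulmxA mulmx_ker mul0mx addr0.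
  by rewrite -scalemxAr.
have sub : (U *m A <= eigenspace (C *m A) a)%MS.
  by apply/eigenspaceP; rewrite mulmxA UAC scalemxAl.
have le_rank : (\rank (kermx X) <= \rank (U *m A))%N.
  apply: leq_trans (mxrankM_maxl (U *m A) C).
  by rewrite UAC mxrank_scale_nz // /U mxrankMfree.
have := leq_trans le_rank (mxrankS sub); rewrite mxrank_ker.
by have := rank_leq_col X; lia.
Qed.

Section Incidence.

Variables (R : realType) (V : finType) (K : {set {set V}}).
Variable o : {set V} -> seq V.

Definition boundary_coef (t s : {set V}) : R :=
  \sum_(j < size (o s)) (-1) ^+ j * oriented_coef R o (omit j (o s)) t.

Lemma boundaryE (i : int) (r : 'I_#|faces K (i - 1)|) (c : 'I_#|faces K i|) :
  boundary R K o i r c = boundary_coef (enum_val r) (enum_val c).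
Proof. by rewrite mxE. Qed.

Hypothesis o_orientation : orientation K o.

Lemma perm_eq_omit (s t : {set V}) (x0 : V) (j : nat) :
  s \in K -> t \in K -> (j < size (o s))%N ->
  perm_eq (omit j (o s)) (o t) = (s :\ nth x0 (o s) j == t).
Proof.
move=> sK tK jlt.
have us : uniq (o s) by rewrite (perm_uniq (o_orientation sK)) enum_uniq.
have ms : o s =i s by move=> x; rewrite (perm_mem (o_orientation sK)) mem_enum.
set x := nth x0 (o s) j.
have -> : omit j (o s) = rem x (o s) by rewrite remE /x index_uniq.
have rem_enum : perm_eq (rem x (o s)) (enum (s :\ x)).
  apply: uniq_perm; rewrite ?rem_uniq ?enum_uniq // => y.
  by rewrite mem_rem_uniq // mem_enum !inE ms.
rewrite (permPl rem_enum) (permPr (o_orientation tK)).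
apply/idP/eqP => [e | -> //].
by apply/setP => y; rewrite -mem_enum (perm_mem e) mem_enum.
Qed.

(** When [t] is [s] without one vertex, only the omission of that vertex
    contributes to the sum, with a sign; otherwise nothing does. *)
Lemma sqr_boundary_coef (s t : {set V}) :
  s \in K -> t \in K -> #|s| = #|t|.+1 ->
  boundary_coef t s ^+ 2 = (t \subset s)%:R.
Proof.
move=> sK tK card_s.
have ms : o s =i s by move=> x; rewrite (perm_mem (o_orientation sK)) mem_enum.
have us : uniq (o s) by rewrite (perm_uniq (o_orientation sK)) enum_uniq.
have [v vs] : exists v, v \in s by apply/set0Pn; rewrite -card_gt0 card_s.
have coef0 (j : 'I_(size (o s))) : s :\ nth v (o s) j != t ->
    (-1) ^+ j * oriented_coef R o (omit j (o s)) t = 0.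
  by move=> ne; rewrite /oriented_coef (perm_eq_omit v) // (negPf ne) mulr0.
have [ts | nts] := boolP (t \subset s); last first.
  rewrite /boundary_coef big1 ?expr0n // => j _; apply: coef0.
  by apply: contraNneq nts => <-; apply: subsetDl.
have /cards1P[w Dw] : #|s :\: t| == 1%N.
  by rewrite cardsD (setIidPr ts) card_s subSnn.
have ws : w \in s by have := set11 w; rewrite -Dw inE => /andP[].
have tE : s :\ w = t by rewrite -Dw setDDr setDv set0U (setIidPr ts).
have wlt : (index w (o s) < size (o s))%N by rewrite index_mem ms.
rewrite /boundary_coef (bigD1 (Ordinal wlt)) //= big1 => [|j ne].
  rewrite addr0 /oriented_coef (perm_eq_omit v) // nth_index ?ms // tE eqxx.
  by rewrite exprMn !sqrr_sign mulr1.
apply: coef0; apply: contraNneq ne => eq_t; apply/eqP/val_inj => /=.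
have -> : w = nth v (o s) j; last by rewrite index_uniq.
apply/eqP; apply: contraTT (ws) => ne.
have : w \notin t by rewrite -tE !inE eqxx.
by rewrite -eq_t !inE ne.
Qed.

Variable d : nat.
Hypothesis K_pure : pure K d%:Z.

(** Every face lies in a facet, which has dimension [d] by purity. *)
Lemma facets_pure : facets K = faces K d%:Z.
Proof.
apply/setP => s; apply/idP/idP => sF.
  rewrite inE (K_pure sF) eqxx andbT.
  by move: sF; rewrite inE => /maxsetp.
move: sF; rewrite inE => /andP[sK /eqP ds].
have [u umax su] := @maxset_exists _ [pred t | t \in K] s sK.
have uF : u \in facets K by rewrite inE.
have := K_pure uF; rewrite -ds /face_dim => /addIr [cu].
by have /eqP -> : s == u by rewrite eqEcard su cu leqnn.
Qed.

Lemma sqr_boundary_coef_ridge (s t : {set V}) :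
  s \in facets K -> t \in ridges K d%:Z ->
  boundary_coef t s ^+ 2 = (t \subset s)%:R.
Proof.
rewrite facets_pure /ridges !inE /face_dim => /andP[sK /eqP cs] /andP[tK /eqP ct].
by apply: sqr_boundary_coef => //; lia.
Qed.

Lemma boundary_coef_eq0 (s t : {set V}) :
  s \in facets K -> t \in ridges K d%:Z -> ~~ (t \subset s) ->
  boundary_coef t s = 0.
Proof.
move=> sF tR nts; apply/eqP.
by rewrite -sqrf_eq0 sqr_boundary_coef_ridge // (negPf nts).
Qed.

(** The left-hand side is an entry of the Gram matrix of the boundary columns.
    A free ridge of the pendant facet [s] is met only by [s] itself, where it
    contributes the square 1; there are [d] such ridges.  The nonfree ridges
    of [s] are quasi-pendant by definition. *)
Lemma boundary_coef_pendant (s u : {set V}) :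
  s \in pendant_facets K d -> u \in facets K ->
  \sum_(t in ridges K d%:Z) boundary_coef t s * boundary_coef t u =
  d%:R * (u == s)%:R
  + \sum_(t in quasi_pendant_ridges K d) boundary_coef t s * boundary_coef t u.
Proof.
move=> sP uF; have := sP; rewrite inE => /andP[sF /eqP card_free].
rewrite (bigID (free_ridge K)) /=; congr (_ + _).
  rewrite (bigID (fun t : {set V} => t \subset s)) /= addrC big1 ?add0r; last first.
    by move=> t /andP[/andP[tR _] ts]; rewrite boundary_coef_eq0 ?mul0r.
  have [-> | nus] := eqVneq u s.
    rewrite mulr1 -[X in _ = X%:R]card_free -sumr_const.
    apply: eq_big => [t | t /andP[/andP[tR _] ts]].
      by rewrite [RHS]inE -andbA [free_ridge K t && _]andbC.
    by rewrite -expr2 sqr_boundary_coef_ridge // ts.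
  rewrite mulr0 big1 // => t /andP[/andP[tR /cards1P[w Dw]] ts].
  rewrite (boundary_coef_eq0 uF tR) ?mulr0 //.
  apply: contra_neqN nus => tu.
  have /set1P -> : u \in [set w] by rewrite -Dw inE uF.
  by have /set1P -> : s \in [set w] by rewrite -Dw inE sF.
rewrite (bigID (mem (quasi_pendant_ridges K d))) /= addrC big1 ?add0r; last first.
  move=> t /andP[/andP[tR nfree] nq].
  rewrite (boundary_coef_eq0 sF tR) ?mul0r //.
  apply: contra nq => ts; rewrite inE tR nfree /=.
  by apply/existsP; exists s; rewrite sP.
apply: eq_bigl => t; rewrite [t \in quasi_pendant_ridges _ _]inE.
by case: (t \in ridges _ _) => //=; case: (free_ridge K t).
Qed.

End Incidence.

Theorem theorem5 (R : realType) (V : finType) (K : {set {set V}}) (d : nat)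
    (o : {set V} -> seq V) (d_ge1 : (1 <= d)%N)
    (K_complex : simplicial_complex K) (K_pure : pure K d%:Z)
    (o_orientation : orientation K o) :
  (eigen_multiplicity (ridge_laplacian R K o d%:Z) d%:R)%:Z
    >= #|pendant_facets K d|%:Z - #|quasi_pendant_ridges K d|%:Z :> int.
Proof.
rewrite lerBlDl -PoszD lez_nat /eigen_multiplicity /ridge_laplacian.
have facetsE := facets_pure K_pure.
have pendant_face s : s \in pendant_facets K d -> s \in faces K d%:Z.
  by rewrite inE -facetsE => /andP[].
(* [X *m Y] is the contribution of the quasi-pendant ridges to the action of
   [B^T *m B] on the pendant facets, the rows of [P]; factoring it through
   these ridges bounds its rank by their number. *)
pose P : 'M[R]_(#|pendant_facets K d|, #|faces K d%:Z|) :=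
  \matrix_(i, c) (enum_val c == enum_val i)%:R.
pose X : 'M[R]_(#|pendant_facets K d|, #|quasi_pendant_ridges K d|) :=
  \matrix_(i, r) boundary_coef R o (enum_val r) (enum_val i).
pose Y : 'M[R]_(#|quasi_pendant_ridges K d|, #|faces K d%:Z|) :=
  \matrix_(r, c) boundary_coef R o (enum_val r) (enum_val c).
have sum_pendant i (f : {set V} -> R) :
    \sum_(c < #|faces K d%:Z|) P i c * f (enum_val c) = f (enum_val i).
  under eq_bigr do rewrite mxE.
  rewrite -(big_enum_val (fun s => (s == enum_val i)%:R * f s)) /=.
  rewrite (bigD1 (enum_val i)) ?pendant_face ?enum_valP //= eqxx mul1r.
  by rewrite big1 ?addr0 // => s /andP[_ /negPf ->]; rewrite mul0r.
apply: (@rank_eigenspace_mulmx _ _ _ _ _ _ _ _ P X Y).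
- by rewrite pnatr_eq0 -lt0n.
- apply/row_freeP; exists P^T; apply/matrixP => i j; rewrite !mxE.
  under eq_bigr do rewrite [P^T _ _]mxE [P j _]mxE.
  by rewrite (sum_pendant i (fun s => (s == enum_val j)%:R)) (inj_eq enum_val_inj).
apply/matrixP => i c; rewrite !mxE.
have uF : enum_val c \in facets K by rewrite facetsE enum_valP.
have sP := enum_valP i.
under [in RHS]eq_bigr do rewrite !mxE.
rewrite -(big_enum_val (fun t =>
  boundary_coef R o t (enum_val i) * boundary_coef R o t (enum_val c))) /=.
rewrite -(boundary_coef_pendant R o_orientation K_pure sP uF).
rewrite [RHS]big_enum_val /=; apply: eq_bigr => r _.
rewrite boundaryE; congr (_ * _); rewrite mxE.
under eq_bigr do rewrite [X in _ * X]mxE boundaryE.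
exact: sum_pendant.
Qed.
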